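(* Almost every $2$-colouring of the hypercube $Q_n$ is reconstructible from the multiset of its coloured $2$-balls. That is, the proportion of colourings $\chi:V(Q_n)\to\{0,1\}$ that are $2$-distinguishable tends to $1$ as $n\to\infty$.
   Context: $Q_n$ is the $n$-dimensional hypercube: vertex set $\{0,1\}^n$, two vertices adjacent iff they differ in exactly one coordinate. Colourings are vertex colourings, not necessarily proper. For a vertex $v$, $B_r(v)$ is the subgraph induced by the vertices at graph distance at most $r$ from $v$, and $\chi^{(r)}(v)=\chi|_{B_r(v)}$ is the coloured $r$-ball around $v$. Colourings $\chi$ of a graph $G$ and $\lambda$ of a graph $H$ are equivalent, $\chi\cong\lambda$, if there is a graph isomorphism $\phi:G\to H$ with $\chi=\lambda\circ\phi$. Colourings $\chi,\lambda$ of $V(Q_n)$ are $r$-locally equivalent, $\chi\cong_r\lambda$, if there is a bijection $f:V(Q_n)\to V(Q_n)$ with $\chi^{(r)}(v)\cong\lambda^{(r)}(f(v))$ for all $v$. A colouring $\chi$ is $r$-distinguishable (reconstructible from the multiset of its coloured $r$-balls) if there is no colouring $\lambda$ of $V(Q_n)$ with $\chi\cong_r\lambda$ but $\chi\not\cong\lambda$. *)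

(* Defs.v *)
From mathcomp Require Import all_boot all_order all_algebra.
From mathcomp Require Import boolp reals.

Set Implicit Arguments.
Unset Strict Implicit.
Unset Printing Implicit Defensive.

Import GRing.Theory.

Local Open Scope ring_scope.

(* The edge relations used below are symmetric and irreflexive, so a finite
   type with such a relation is a finite simple graph. *)

(* d(x, y) <= r exactly when some walk of length at most r joins x to y. *)
Definition dist_le (T : finType) (e : rel T) (r : nat) (x y : T) : bool :=
  [exists k : 'I_r.+1, exists p : k.-tuple T, path e x p && (last x p == y)].

Definition ball (T : finType) (e : rel T) (r : nat) (v : T) : {set T} :=
  [set w | dist_le e r v w].

Definition induced (T : finType) (e : rel T) (S : {set T}) :
    rel {x : T | x \in S} :=
  fun x y => e (val x) (val y).

Definition graph_iso (G H : finType) (eG : rel G) (eH : rel H) (phi : G -> H) :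
    Prop :=
  bijective phi /\ (forall x y, eG x y = eH (phi x) (phi y)).

Definition col_equiv (C : Type) (G H : finType) (eG : rel G) (eH : rel H)
    (chi : G -> C) (lam : H -> C) : Prop :=
  exists2 phi : G -> H, graph_iso eG eH phi & chi =1 lam \o phi.

Definition col_ball (C : Type) (T : finType) (e : rel T) (r : nat)
    (chi : T -> C) (v : T) : {x : T | x \in ball e r v} -> C :=
  fun x => chi (val x).

(* As in the definition of equivalence of colourings, the isomorphism between
   the two balls is not required to map v to f v. *)
Definition local_equiv (C : Type) (T : finType) (e : rel T) (r : nat)
    (chi lam : T -> C) : Prop :=
  exists2 f : T -> T, bijective f &
    forall v : T,
      col_equiv (@induced T e (ball e r v)) (@induced T e (ball e r (f v)))
        (@col_ball C T e r chi v) (@col_ball C T e r lam (f v)).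

Definition distinguishable (C : Type) (T : finType) (e : rel T) (r : nat)
    (chi : T -> C) : Prop :=
  ~ exists lam : T -> C, local_equiv e r chi lam /\ ~ col_equiv e e chi lam.

Notation cube n := {ffun 'I_n -> bool}.

Definition cube_adj (n : nat) : rel (cube n) :=
  fun x y => #|[set i : 'I_n | x i != y i]| == 1%N.

Definition proportion (R : realType) (T : finType) (P : T -> Prop) : R :=
  #|[pred x : T | `[< P x >]]|%:R / #|T|%:R.

(* Main.v *)
Require Import Defs.
From mathcomp Require Import all_boot all_order all_algebra zify.

Set Implicit Arguments.
Unset Strict Implicit.
Unset Printing Implicit Defensive.

Import GRing.Theory.

(* View the cube as F_2^n with unit vectors e_i. A colouring lam with the same 2-balls as chi
   attaches to every vertex w a vertex g(w) and a permutation pi_w of the directions such that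
   lam(w + e_i + e_j) = chi(g(w) + e_(pi_w i) + e_(pi_w j)).

   Fix w and put v_i = g(w + e_i), pi_i = pi_(w + e_i). The vertex w + e_i + e_j + e_k lies in three
   of these balls, which forces
     chi(v_i + e_(pi_i j) + e_(pi_i k)) = chi(v_j + e_(pi_j i) + e_(pi_j k)).
   There are only 2^(O(n^2 log n)) families (v_i, pi_i), so for almost every chi no compatible
   family has more than O(n^2 log n) points of the cube in nontrivial such equations. Two distinct
   2-balls share O(n) points, so by Cauchy-Schwarz only o(n^3) of the triples (i, j, k) give a
   nontrivial equation. Hence for suitable v and sigma, v_j = v + e_(sigma j) and
   pi_j k = sigma k for all but o(n^2 / log n) pairs (j, k).

   The balls around w and around each w + e_l are now prescribed by (v, sigma) outside this small
   set of pairs, and n^2 / 2 equations against 2^(o(n^2)) configurations leave, for almost every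
   chi, only g(w) = v and g(w + e_l) adjacent to v. So g preserves adjacency. *)

(** * Counting *)

(* If [h y] precedes [y] for all [y] in [Z], a member of [X] is determined by its values off [Z]. *)
Lemma card_collapse_rank (T : finType) (r : T -> nat)
    (X : {set {ffun T -> bool}}) (Z : {set T}) (h : T -> T) :
  (forall y, y \in Z -> r (h y) < r y) ->
  (forall y (chi : {ffun T -> bool}),
      y \in Z -> chi \in X -> chi (h y) = chi y) ->
  #|X| * 2 ^ #|Z| <= 2 ^ #|T|.
Proof.
move=> h_lt h_eq.
pose trace (chi : {ffun T -> bool}) := [set x in ~: Z | chi x].
have trace_inj : {in X &, injective trace}.
  move=> chi1 chi2 X1 X2 /setP eq_tr; apply/ffunP => x.
  have [m] := ubnP (r x); elim: m x => // m IH x le_x.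
  have [Zx | Z'x] := boolP (x \in Z).
    by rewrite -!(h_eq x) // IH // (leq_trans (h_lt _ Zx)).
  by have := eq_tr x; rewrite !inE Z'x.
rewrite -(card_in_imset trace_inj) -(cardsC Z) addnC expnD leq_pmul2r ?expn_gt0 //.
rewrite -card_powerset subset_leq_card //.
apply/subsetP => _ /imsetP[chi _ ->]; rewrite powersetE.
by apply/subsetP => x; rewrite !inE => /andP[].
Qed.

(** The map [h] may have cycles, so [Y] is split by whether [h] lowers or raises the enumeration
    rank. Within each part the values can be recovered recursively, and one part has at least [s]
    points. *)
Lemma card_collapse (T : finType) (X : {set {ffun T -> bool}}) (Y : {set T}) s :
  (forall y, y \in Y ->
     exists z, z != y /\ forall chi : {ffun T -> bool}, chi \in X -> chi z = chi y) ->
  2 * s <= #|Y| -> #|X| * 2 ^ s <= 2 ^ #|T|.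
Proof.
move=> exY le_s.
pose good y z := (z != y) && [forall chi in X, chi z == chi y].
pose h y := odflt y [pick z | good y z].
have hP y : y \in Y -> good y (h y).
  move=> /exY[z [zy Hz]]; rewrite /h; case: pickP => [//|/(_ z)].
  by rewrite /good zy /= => /negP[]; apply/forall_inP=> chi /Hz ->.
have h_eq y (chi : {ffun T -> bool}) : y \in Y -> chi \in X -> chi (h y) = chi y.
  by move=> /hP/andP[_ /forall_inP H] /H /eqP.
pose r (y : T) : nat := enum_rank y; pose r' y := #|T| - r y.
pose Z := [set y in Y | r (h y) < r y]; pose Z' := [set y in Y | r' (h y) < r' y].
have le1 : #|X| * 2 ^ #|Z| <= 2 ^ #|T|.
  by apply: (@card_collapse_rank _ r _ _ h) => [y | y chi]; rewrite inE => /andP[] // /h_eq e _ /e.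
have le2 : #|X| * 2 ^ #|Z'| <= 2 ^ #|T|.
  by apply: (@card_collapse_rank _ r' _ _ h) => [y | y chi]; rewrite inE => /andP[] // /h_eq e _ /e.
have leY : #|Y| <= #|Z| + #|Z'|.
  apply: leq_trans (leq_card_setU Z Z'); rewrite subset_leq_card //; apply/subsetP=> y Yy.
  have lt_r x : r x < #|T| by exact: ltn_ord.
  have ne_r : r (h y) != r y.
    by have /andP[+ _] := hP y Yy; rewrite -(inj_eq (@enum_rank_inj T)) -(inj_eq val_inj).
  have key a b c : a < c -> b < c -> b != a -> (b < a) || (c - b < c - a) by lia.
  by rewrite !inE Yy key.
have: (s <= #|Z|) || (s <= #|Z'|) by lia.
by case/orP=> le_sZ; [apply: leq_trans le1 | apply: leq_trans le2];
  rewrite leq_mul2l leq_pexp2l ?orbT.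
Qed.

Lemma union_bound (C T : finType) (Q : C -> {set T}) a M :
  (forall c, #|Q c| * a <= M) -> #|\bigcup_c Q c| * a <= #|C| * M.
Proof.
move=> le_Q; have le_U : #|\bigcup_c Q c| <= \sum_c #|Q c|.
  elim/big_rec2: _ => [|c m U _ le_U]; first by rewrite cards0.
  by rewrite (leq_trans (leq_card_setU _ _)) // leq_add2l.
rewrite (leq_trans (leq_mul le_U (leqnn a))) // big_distrl /= -sum_nat_const.
exact: leq_sum.
Qed.

Lemma leq_card_fiber (A B : finType) (S : {set A}) (f : A -> B) (U : {set B}) m :
  (forall a, a \in S -> f a \in U) ->
  (forall u, u \in U -> #|[set a in S | f a == u]| <= m) -> #|S| <= m * #|U|.
Proof.
move=> fU le_m; rewrite -sum1_card (partition_big f (mem U)) //= mulnC -sum_nat_const.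
apply: leq_sum => u /le_m; apply: leq_trans.
by rewrite sum1dep_card; apply: eq_leq; apply: eq_card => a; rewrite !inE.
Qed.

(* Cauchy-Schwarz for the fibre sizes [b]: sum [2 t b <= t ^ 2 + b ^ 2] over the image. *)
Lemma card_collisions (A B : finType) (S S' : {set A}) (f : A -> B) t :
  S' \subset S ->
  2 * t * #|S'| <= t ^ 2 * #|f @: S'| +
    #|[set q : A * A | [&& q.1 \in S, q.2 \in S & f q.1 == f q.2]]|.
Proof.
move=> sS; pose b u := #|[set a in S | f a == u]|.
have le1 : #|S'| <= \sum_(u in f @: S') b u.
  rewrite -sum1_card (partition_big_imset f) /=; apply: leq_sum => u _.
  rewrite sum1dep_card subset_leq_card //; apply/subsetP => a.
  by rewrite !inE => /andP[/(subsetP sS) -> ->].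
have le2 : \sum_(u in f @: S') b u ^ 2 <=
    #|[set q : A * A | [&& q.1 \in S, q.2 \in S & f q.1 == f q.2]]|.
  rewrite -sum1_card (partition_big (fun q => f q.1) predT) //=.
  rewrite [leqRHS](bigID (mem (f @: S'))) /= -[leqLHS]addn0 leq_add //.
  apply: leq_sum => u _; rewrite sum1dep_card expnS expn1 -cardsX subset_leq_card //.
  apply/subsetP=> -[p q]; rewrite !inE /= => /andP[/andP[-> /eqP->] /andP[-> /eqP->]].
  by rewrite !eqxx.
apply: leq_trans (leq_add (leqnn _) le2).
apply: leq_trans (leq_mul (leqnn _) le1) _.
rewrite big_distrr [t ^ 2 * _]mulnC -sum_nat_const -big_split /=.
by apply: leq_sum => u _; rewrite -mulnA (nat_Cauchy t (b u)).1.
Qed.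

Lemma leq_card_injection (A B : finType) (S : {set A}) (U : {set B}) (f : A -> B) :
  {in S &, injective f} -> (forall a, a \in S -> f a \in U) -> (#|S| <= #|U|)%N.
Proof.
move=> f_inj fU; rewrite -(card_in_imset f_inj) subset_leq_card //.
by apply/subsetP=> _ /imsetP[a /fU + ->].
Qed.

(** Padding to a fixed length lets a small set of exceptions be stored in a tuple type, which has
    few elements. *)
Lemma subset_tuple (T : finType) (B : {set T}) (x : T) m : (#|B| <= m)%N ->
  exists t : m.-tuple T, {subset B <= t}.
Proof.
move=> le_m; pose s := enum B ++ nseq (m - #|B|) x.
have sz : size s == m by rewrite size_cat -cardE size_nseq subnKC.
by exists (Tuple sz) => y yB; rewrite mem_cat mem_enum yB.
Qed.

(** * The cube as a vector space over F_2 *)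

Local Open Scope ring_scope.

Definition unit_vec n (i : 'I_n) : cube n := [ffun j => j == i].
(** [None] encodes the zero shift, so the same configurations serve the ball around a vertex and the
    balls around its neighbours. *)
Definition opt_vec n (u : option 'I_n) : cube n := oapp (@unit_vec n) 0 u.
Definition supp n (x : cube n) : {set 'I_n} := [set i | x i].

Local Notation e := unit_vec.

Section CubeAlgebra.
Variable n : nat.
Implicit Types (x y z : cube n) (a b c d : 'I_n).

Lemma add_self x : x + x = 0.
Proof. by apply/ffunP=> i; rewrite !ffunE; case: (x i). Qed.

Lemma add_selfK x y : y + x + x = y.
Proof. by rewrite -addrA add_self addr0. Qed.

Lemma add_eq_swap x y z : x + y = z -> x = z + y.
Proof. by move=> <-; rewrite add_selfK. Qed.

Lemma add_eq0_eq x y : x + y = 0 -> x = y.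
Proof. by move/add_eq_swap; rewrite add0r. Qed.

Lemma unit_vecE a b : e a b = (b == a).
Proof. by rewrite ffunE. Qed.

Lemma unit_vec_inj : injective (@unit_vec n).
Proof. by move=> a b /ffunP/(_ a); rewrite !unit_vecE eqxx => /esym/eqP. Qed.

Lemma add_unit_eq a b c d : a != b -> e a + e b = e c + e d ->
  (a = c /\ b = d) \/ (a = d /\ b = c).
Proof.
move=> ab /ffunP eq_v; move: (eq_v a) (eq_v b).
rewrite !ffunE !eqxx (eq_sym b a) (negPf ab) /=.
have [<-|_] := eqVneq a c.
  by rewrite (eq_sym b a) (negPf ab) => _ /esym/eqP; left.
have [<-|//] := eqVneq a d.
by rewrite (eq_sym b a) (negPf ab) !addr0 !add0r => _ /esym/eqP; right.
Qed.

Lemma card_supp_unit a : #|supp (e a)| = 1%N.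
Proof.
by rewrite -(cards1 a); apply: eq_card => i; rewrite !inE unit_vecE.
Qed.

Lemma card_suppD x y : (#|supp (x + y)%R| <= #|supp x| + #|supp y|)%N.
Proof.
apply: leq_trans (leq_card_setU _ _); rewrite subset_leq_card //.
by apply/subsetP=> i; rewrite !inE !ffunE; case: (x i) (y i) => [] [].
Qed.

Lemma card_supp_opt (u : option 'I_n) : (#|supp (opt_vec u)| <= 1)%N.
Proof.
case: u => [a|] /=; first by rewrite card_supp_unit.
by rewrite (_ : supp _ = set0) ?cards0 //; apply/setP => i; rewrite !inE ffunE.
Qed.

(* A nonzero sum of two pairs has at least two points in its support, and [opt_vec u] cancels at
   most one of them. *)
Lemma supp_hit x (u : option 'I_n) a b c d :
  a != b -> c != d -> x != opt_vec u ->
  e a + e b + (e c + e d) = x + opt_vec u ->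
  [|| a \in supp x, b \in supp x, c \in supp x | d \in supp x].
Proof.
move=> ab cd xu /ffunP eq_v; apply/negbNE/negP; rewrite !negb_or !inE.
move=> /and4P[xa xb xc xd].
have uP p q : opt_vec u p -> opt_vec u q -> p = q.
  by case: u {xu eq_v} => [i|] /=; rewrite !ffunE // => /eqP-> /eqP->.
have uE p : x p = false -> opt_vec u p = (p == a) (+) (p == b) (+) ((p == c) (+) (p == d)).
  by move=> xp; have := eq_v p; rewrite !ffunE xp.
move: (uE a (negPf xa)) (uE b (negPf xb)) (uE c (negPf xc)) (uE d (negPf xd)).
rewrite !eqxx !(eq_sym b a) !(eq_sym c a) !(eq_sym d a) !(eq_sym c b) !(eq_sym d b) (eq_sym d c).
rewrite (negPf ab) (negPf cd).
have sum0 : e a + e b + (e c + e d) <> 0.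
  move=> sum0; case/eqP: xu; apply: add_eq0_eq; apply/ffunP=> i.
  by rewrite -eq_v sum0.
have [ac|ac] := eqVneq a c.
  have [bd|bd] := eqVneq b d; first by case: sum0; rewrite -ac -bd add_self.
  rewrite -ac (eq_sym b a) (negPf ab) ac (negPf cd) => _ ub _ ud.
  by rewrite (uP b d ub ud) eqxx in bd.
have [ad|ad] := eqVneq a d.
  have [bc|bc] := eqVneq b c; first by case: sum0; rewrite -ad -bc [e b + _]addrC add_self.
  rewrite -ad (eq_sym b a) (negPf ab) => _ ub uc _.
  by rewrite (uP b c ub uc) eqxx in bc.
move=> ua; have [bc|bc] := eqVneq b c.
  rewrite bc (negPf cd) => _ _ ud.
  by rewrite (uP a d ua ud) eqxx in ad.
have [bd|bd] := eqVneq b d.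
  by move=> _ uc _; rewrite (uP a c ua uc) eqxx in ac.
by move=> ub _ _; rewrite (uP a b ua ub) eqxx in ab.
Qed.

Lemma card_supp_sum (u : option 'I_n) a b c d :
  (#|supp (e a + e b + (e c + e d) + opt_vec u)%R| <= 5)%N.
Proof.
have := card_suppD (e a + e b + (e c + e d)) (opt_vec u).
have := card_suppD (e a + e b) (e c + e d); have := card_suppD (e a) (e b).
have := card_suppD (e c) (e d); have := card_supp_opt u.
by rewrite !card_supp_unit; lia.
Qed.

End CubeAlgebra.

(** Identities and linear consequences in F_2^n are checked at each coordinate, where they become
    Boolean tautologies. *)
Ltac case_F2 z :=
  rewrite !ffunE;
  repeat match goal with
  | |- context [@fun_of_fin _ _ _ ?x z] => case: (x z)
  | |- context [z == ?t] => case: (z == t)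
  end; by [].

Ltac ident_F2 := let z := fresh "z" in apply/ffunP => z; case_F2 z.

Ltac linear_F2 H :=
  let z := fresh "z" in let Hz := fresh "Hz" in
  have /ffunP Hz := H; apply/ffunP => z; move: (Hz z); case_F2 z.

Section PairCounting.
Variable n : nat.
Implicit Types (pi : 'I_n -> 'I_n) (S : {set 'I_n}).

Lemma card_hit pi S : injective pi ->
  (#|[set p : 'I_n * 'I_n | (pi p.1 \in S) || (pi p.2 \in S)]| <= 2 * (#|S| * n))%N.
Proof.
move=> pi_inj; pose P := pi @^-1: S.
have leP : (#|P| <= #|S|)%N.
  rewrite -(card_imset _ pi_inj) subset_leq_card //.
  by apply/subsetP=> _ /imsetP[i + ->]; rewrite inE.
apply: (@leq_trans #|setX P setT :|: setX setT P|).
  by rewrite subset_leq_card //; apply/subsetP=> -[j k]; rewrite !inE andbT.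
apply: leq_trans (leq_card_setU _ _) _; rewrite !cardsX cardsT card_ord.
by move: #|S| #|P| leP => s m le_m; rewrite (mulnC n) addnn -mul2n leq_mul2l leq_mul2r le_m orbT.
Qed.

(** The value [y] fixes a sum of two distinct unit vectors, hence an unordered pair, which has two
    orderings. *)
Lemma card_pair_fiber pi (x y : cube n) : injective pi ->
  (#|[set p : 'I_n * 'I_n | (p.1 != p.2) && (x + e (pi p.1) + e (pi p.2) == y)%R]| <= 2)%N.
Proof.
move=> pi_inj; set F := [set p | _].
have [->|[[j k] Fjk]] := set_0Vmem F; first by rewrite cards0.
apply: (@leq_trans #|[set (j, k); (k, j)]|); last by rewrite cards2; case: (_ != _).
rewrite subset_leq_card //; apply/subsetP=> -[j' k'].
move: Fjk; rewrite !inE /= => /andP[jk /eqP <-] /andP[jk' /eqP].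
rewrite -!addrA => /addrI /add_unit_eq; rewrite (inj_eq pi_inj) => /(_ jk').
by case=> -[/pi_inj-> /pi_inj->]; rewrite eqxx ?orbT.
Qed.

End PairCounting.

(** * Families of candidate 2-balls *)

(* A candidate 2-ball: its centre and the images of the [n] directions. *)
Local Notation frame n := (cube n * {ffun 'I_n -> 'I_n})%type.

Definition pt n (a : frame n) (p : 'I_n * 'I_n) : cube n :=
  a.1 + e (a.2 p.1) + e (a.2 p.2).

(** At a common point the displacement [D] of the centres is a nonzero sum of four unit vectors, so
    by [supp_hit] one of the two pairs has a direction in [supp D]. That pair has at most [10 * n]
    choices and the other one then at most 2; either side may be the one hit. *)
Lemma card_frame_meet n (a b : frame n) :
  a.1 != b.1 -> injective a.2 -> injective b.2 ->
  (#|[set q : ('I_n * 'I_n) * ('I_n * 'I_n) |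
       [&& q.1.1 != q.1.2, q.2.1 != q.2.2 & pt a q.1 == pt b q.2]]| <= 40 * n)%N.
Proof.
move=> ab a_inj b_inj; set Q := [set q | _].
have [->|[q0 Qq0]] := set_0Vmem Q; first by rewrite cards0.
pose D := a.1 + b.1.
have QD q : q \in Q -> e (a.2 q.1.1) + e (a.2 q.1.2) + (e (b.2 q.2.1) + e (b.2 q.2.2)) = D.
  by rewrite inE => /and3P[_ _ /eqP Hq]; rewrite /pt in Hq; rewrite /D; linear_F2 Hq.
have D0 : D != opt_vec None by apply: contra_neq ab => /add_eq0_eq.
have le5 : (#|supp D| <= 5)%N.
  have := card_supp_sum None (a.2 q0.1.1) (a.2 q0.1.2) (b.2 q0.2.1) (b.2 q0.2.2).
  by rewrite addr0 QD.
pose hit (f : {ffun 'I_n -> 'I_n}) := [set p | (f p.1 \in supp D) || (f p.2 \in supp D)].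
pose Qa := [set q in Q | q.1 \in hit a.2]; pose Qb := [set q in Q | q.2 \in hit b.2].
have leQ : (#|Q| <= #|Qa| + #|Qb|)%N.
  apply: leq_trans (leq_card_setU Qa Qb); rewrite subset_leq_card //.
  apply/subsetP=> q Qq; have := Qq; rewrite inE => /and3P[q1 q2 _].
  have := @supp_hit _ D None (a.2 q.1.1) (a.2 q.1.2) (b.2 q.2.1) (b.2 q.2.2).
  rewrite (inj_eq a_inj) (inj_eq b_inj) addr0 => /(_ q1 q2 D0 (QD _ Qq)).
  by case/or4P=> h; apply/setUP; [left|left|right|right]; apply/setIdP;
    split=> //; rewrite inE h ?orbT.
have [ha hb] : (#|hit a.2| <= 2 * (#|supp D| * n))%N /\ (#|hit b.2| <= 2 * (#|supp D| * n))%N.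
  by split; apply: card_hit.
have leQa : (#|Qa| <= 2 * #|hit a.2|)%N.
  apply: (@leq_card_fiber _ _ _ (fun q => q.1)) => [q|p _]; first by rewrite !inE => /andP[].
  apply: leq_trans (card_pair_fiber b.1 (pt a p) b_inj).
  apply: (@leq_card_injection _ _ _ _ (fun q => q.2)).
    move=> [q1 q2] [r1 r2]; rewrite !inE /= => /andP[_ /eqP->] /andP[_ /eqP->].
    by move=> ->.
  by case=> q1 q2; rewrite !inE /= => /andP[/andP[/and3P[_ -> /eqP qq] _] /eqP<-]; apply/eqP.
have leQb : (#|Qb| <= 2 * #|hit b.2|)%N.
  apply: (@leq_card_fiber _ _ _ (fun q => q.2)) => [q|p _]; first by rewrite !inE => /andP[].
  apply: leq_trans (card_pair_fiber a.1 (pt b p) a_inj).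
  apply: (@leq_card_injection _ _ _ _ (fun q => q.1)).
    move=> [q1 q2] [r1 r2]; rewrite !inE /= => /andP[_ /eqP->] /andP[_ /eqP->].
    by move=> ->.
  by case=> q1 q2; rewrite !inE /= => /andP[/andP[/and3P[-> _ /eqP qq] _] /eqP<-]; apply/eqP.
move: #|Q| #|Qa| #|Qb| #|hit _| #|hit _| #|supp D| le5 leQ ha hb leQa leQb; clear.
nia.
Qed.

Section Family.
Variables (n : nat) (c : {ffun 'I_n -> frame n}).
Hypotheses (c_inj : injective (fun i => (c i).1)) (pi_inj : forall i, injective (c i).2).

(* The triple [(i, (j, k))] stands for the point at [{j, k}] in the [i]-th 2-ball. *)
Local Notation triple := ('I_n * ('I_n * 'I_n))%type.

Definition fpt (p : triple) : cube n := pt (c p.1) p.2.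
Definition swap (p : triple) : triple := (p.2.1, (p.1, p.2.2)).

(** Balls [i] and [j] see the same vertex w + e_i + e_j + e_k at the triples [p] and [swap p]. Only
    different images of it give a nontrivial equation on the colouring. *)
Definition conflicts : {set triple} :=
  [set p | [&& p.1 != p.2.1, p.1 != p.2.2, p.2.1 != p.2.2 & fpt p != fpt (swap p)]].

(** One ball passes through a point at most twice, which gives [2 * n ^ 3]; each of the at most
    [n ^ 2] pairs of different balls gives [40 * n]. *)
Lemma card_fpt_collisions :
  (#|[set q : triple * triple |
      [&& q.1 \in [set p : triple | p.2.1 != p.2.2],
          q.2 \in [set p : triple | p.2.1 != p.2.2] & fpt q.1 == fpt q.2]]| <= 42 * n ^ 3)%N.
Proof.
set R := [set q | _].
pose Rd := [set q in R | q.1.1 == q.2.1]; pose Ro := [set q in R | q.1.1 != q.2.1].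
have leR : (#|R| <= #|Rd| + #|Ro|)%N.
  apply: leq_trans (leq_card_setU Rd Ro); rewrite subset_leq_card //.
  by apply/subsetP=> q Rq; apply/setUP;
    case: (boolP (q.1.1 == q.2.1)) => h; [left|right]; apply/setIdP.
have leRd : (#|Rd| <= 2 * #|[set: triple]|)%N.
  apply: (@leq_card_fiber _ _ _ (fun q => q.1)) => [q|p _]; first by rewrite inE.
  apply: leq_trans (card_pair_fiber (c p.1).1 (fpt p) (@pi_inj p.1)).
  apply: (@leq_card_injection _ _ _ _ (fun q => q.2.2)).
    move=> [q1 [i1 q2]] [r1 [i2 r2]]; rewrite !inE /=.
    move=> /andP[/andP[_ /eqP<-] /eqP->] /andP[/andP[_ /eqP<-] /eqP->].
    by move=> ->.
  case=> [q1 [i1 q2]]; rewrite !inE /= => /andP[/andP[/and3P[_ -> qq] /eqP e1] /eqP<-] /=.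
  by rewrite e1 eq_sym.
have leRo : (#|Ro| <= 40 * n * #|[set: 'I_n * 'I_n]|)%N.
  apply: (@leq_card_fiber _ _ _ (fun q => (q.1.1, q.2.1))) => [q|[i i'] _]; first by rewrite inE.
  have [<-|ii] := eqVneq i i'.
    rewrite (_ : [set a in _ | _] = set0) ?cards0 //; apply/setP=> -[[i1 q1] [i2 q2]].
    rewrite !inE /= xpair_eqE; apply/negP=> /andP[/andP[_ ii] /andP[/eqP e1 /eqP e2]].
    by rewrite e1 e2 eqxx in ii.
  have ii1 : (c i).1 != (c i').1 by rewrite (inj_eq c_inj).
  apply: leq_trans (card_frame_meet ii1 (@pi_inj i) (@pi_inj i')).
  apply: (@leq_card_injection _ _ _ _ (fun q => (q.1.2, q.2.2))).
    move=> [[i1 q1] [i2 q2]] [[i3 q3] [i4 q4]]; rewrite !inE /= !xpair_eqE.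
    move=> /andP[_ /andP[/eqP-> /eqP->]] /andP[_ /andP[/eqP-> /eqP->]].
    by case=> -> ->.
  move=> [[i1 q1] [i2 q2]]; rewrite !inE /= !xpair_eqE.
  by move=> /andP[/andP[/and3P[-> -> ee] _] /andP[/eqP<- /eqP<-]].
rewrite !cardsT !card_prod !card_ord in leRd leRo.
rewrite (leq_trans leR) // (leq_trans (leq_add leRd leRo)) // !expnS expn0; lia.
Qed.

Lemma card_conflicts t :
  (2 * t * #|conflicts| <= t ^ 2 * #|fpt @: conflicts| + 42 * n ^ 3)%N.
Proof.
apply: leq_trans (leq_add (leqnn _) card_fpt_collisions); apply: card_collisions.
by apply/subsetP=> p; rewrite !inE => /and4P[].
Qed.

End Family.

(** * Agreement between the 2-balls around the neighbours of a vertex *)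

Section Agreement.
Variables (n : nat) (c : {ffun 'I_n -> frame n}).
Hypothesis pi_inj : forall i, injective (c i).2.
Local Notation triple := ('I_n * ('I_n * 'I_n))%type.

(* Zero iff the balls [i] and [j] place the vertex [w + e_i + e_j] at the same point. *)
Definition skew (i j : 'I_n) : cube n :=
  (c i).1 + (c j).1 + (e ((c i).2 j) + e ((c j).2 i)).

Definition disagreements : {set triple} :=
  [set p | (skew p.1 p.2.1 != 0) || ((c p.1).2 p.2.2 != (c p.2.1).2 p.2.2)].

Lemma skew_fpt p : fpt c p = fpt c (swap p) ->
  skew p.1 p.2.1 = e ((c p.1).2 p.2.2) + e ((c p.2.1).2 p.2.2).
Proof. by rewrite /fpt /pt /skew => H; linear_F2 H. Qed.

(** For distinct indices without conflict, [skew i j] is the sum of the images of [k] under the two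
    permutations. If it vanishes, the images agree; otherwise it determines the two images as a set,
    so [(i, j)] admits at most two such [k]. Coinciding indices account for the other
    [2 * n ^ 2]. *)
Lemma card_disagreements : (#|disagreements| <= #|conflicts c| + 4 * n ^ 2)%N.
Proof.
pose X1 := [set p : triple | p.1 == p.2.2]; pose X2 := [set p : triple | p.2.1 == p.2.2].
pose X3 := [set p : triple | (skew p.1 p.2.1 != 0) && (fpt c p == fpt c (swap p))].
have le_dis : (#|disagreements| <= #|conflicts c| + (#|X1| + (#|X2| + #|X3|)))%N.
  have h : disagreements \subset conflicts c :|: (X1 :|: (X2 :|: X3)).
    apply/subsetP=> -[i [j k]]; rewrite !inE /=.
    have [->|ik] := eqVneq i k; first by rewrite !orbT.
    have [->|jk] := eqVneq j k; first by rewrite !orbT.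
    have [<-|ij] := eqVneq i j; first by rewrite /skew !add_self !eqxx.
    have [/skew_fpt /= Ds|//] := eqVneq (fpt c (i, (j, k))) (fpt c (swap (i, (j, k)))).
    rewrite andbT; case: (eqVneq (skew i j) 0) => //= D0; apply: contraR => _.
    by move/esym: Ds; rewrite D0 => /add_eq0_eq/unit_vec_inj ->.
  apply: leq_trans (subset_leq_card h) _.
  do 3!(apply: leq_trans (leq_card_setU _ _) _; rewrite leq_add2l).
  exact: leqnn.
have le1 : (#|X1| <= #|[set: 'I_n * 'I_n]|)%N.
  apply: (@leq_card_injection _ _ _ _ (fun p => p.2)) => [[i [j k]] [i' [j' k']]|//].
  by rewrite !inE /= => /eqP-> /eqP-> [-> ->].
have le2 : (#|X2| <= #|[set: 'I_n * 'I_n]|)%N.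
  apply: (@leq_card_injection _ _ _ _ (fun p => (p.1, p.2.1))) => [[i [j k]] [i' [j' k']]|//].
  by rewrite !inE /= => /eqP<- /eqP<- [-> ->].
have le3 : (#|X3| <= 2 * #|[set: 'I_n * 'I_n]|)%N.
  apply: (@leq_card_fiber _ _ _ (fun p => (p.1, p.2.1))) => [//|[i j] _]; set F := [set p in _ | _].
  have [->|[[i0 [j0 k0]]]] := set_0Vmem F; first by rewrite cards0.
  rewrite !inE /= xpair_eqE => /andP[/andP[D0 /eqP/skew_fpt /= Dk] /andP[/eqP ei /eqP ej]].
  rewrite ei ej in D0 Dk.
  pose a := (c i).2 k0; pose b := (c j).2 k0; rewrite -/a -/b in Dk.
  have ab : a != b by apply: contraNneq D0 => ab; rewrite Dk ab add_self.
  apply: (@leq_trans #|[set a; b]|); last by rewrite cards2; case: (_ != _).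
  apply: (@leq_card_injection _ _ _ _ (fun p => (c i).2 p.2.2)).
    move=> [i1 [j1 k1]] [i2 [j2 k2]]; rewrite !inE /= !xpair_eqE.
    by move=> /andP[_ /andP[/eqP-> /eqP->]] /andP[_ /andP[/eqP-> /eqP->]] /pi_inj ->.
  move=> [i1 [j1 k1]]; rewrite !inE /= !xpair_eqE.
  move=> /andP[/andP[_ /eqP/skew_fpt /= D1] /andP[/eqP e1 /eqP e2]]; subst i1 j1.
  by move: D1; rewrite Dk => /(add_unit_eq ab)[] [-> ->]; rewrite eqxx ?orbT.
move: le_dis le1 le2 le3; rewrite !cardsT !card_prod !card_ord expnS expn1.
by move: #|X1| #|X2| #|X3| #|conflicts c| #|disagreements|; clear; lia.
Qed.

(** Ball [a] supplies the common permutation and ball [b] the common centre. The four conditions let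
    [skew b j = 0] be rewritten with the permutation of [a] alone. *)
Definition exceptions (a b : 'I_n) : {set 'I_n * 'I_n} :=
  [set q | [|| (a, q) \in disagreements, (b, q) \in disagreements,
               (a, (q.1, b)) \in disagreements | (a, (b, q.1)) \in disagreements]].

(** Averaging over [(a, b)]: in the sum over [a], [b], [j], [k], each of the four conditions leaves
    one index free and so contributes [n] times the number of disagreements. *)
Lemma exists_few_exceptions : (0 < n)%N ->
  exists a b, (n * #|exceptions a b| <= 4 * #|disagreements|)%N.
Proof.
move=> n_gt0; pose d i j k : nat := (i, (j, k)) \in disagreements.
have disE : #|disagreements| = \sum_i \sum_j \sum_k d i j k.
  rewrite -sum1_card big_mkcond /= (eq_bigr (fun p => d p.1 p.2.1 p.2.2)); last first.
    by case=> i [j k] _; rewrite /d /=; case: (_ \in _).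
  rewrite -(pair_bigA _ (fun i q => d i q.1 q.2)) /=.
  by apply: eq_bigr => i _; rewrite pair_bigA.
have exE a b : (#|exceptions a b| <=
    \sum_j \sum_k (d a j k + d b j k + d a j b + d a b j))%N.
  rewrite -sum1_card big_mkcond pair_bigA /=; apply: leq_sum => -[j k] _; rewrite inE /= /d.
  by do 4!case: (_ \in _).
have sum_ex : (\sum_a \sum_b #|exceptions a b| <= 4 * n * #|disagreements|)%N.
  apply: (@leq_trans (\sum_a \sum_b \sum_j \sum_k (d a j k + d b j k + d a j b + d a b j))%N).
    by apply: leq_sum => a _; apply: leq_sum => b _.
  have -> : (4 * n * #|disagreements| = n * #|disagreements| + n * #|disagreements| +
     n * #|disagreements| + n * #|disagreements|)%N by lia.
  apply: eq_leq.
  have split2 (F G : 'I_n -> 'I_n -> nat) : (\sum_j \sum_k (F j k + G j k) =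
      \sum_j \sum_k F j k + \sum_j \sum_k G j k)%N.
    by rewrite -big_split /=; apply: eq_bigr => j _; rewrite big_split.
  have split4 (F G : 'I_n -> 'I_n -> 'I_n -> 'I_n -> nat) :
      (\sum_a \sum_b \sum_j \sum_k (F a b j k + G a b j k) =
       \sum_a \sum_b \sum_j \sum_k F a b j k + \sum_a \sum_b \sum_j \sum_k G a b j k)%N.
    by rewrite -split2; apply: eq_bigr => a _; apply: eq_bigr => b _; rewrite split2.
  rewrite !split4; congr (_ + _ + _ + _)%N.
  - rewrite disE big_distrr /=; apply: eq_bigr => a _.
    by rewrite sum_nat_const card_ord.
  - by rewrite sum_nat_const card_ord disE.
  - rewrite disE big_distrr /=; apply: eq_bigr => a _.
    under eq_bigr => b _ do under eq_bigr => j _ do rewrite sum_nat_const card_ord.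
    under eq_bigr => b _ do rewrite -big_distrr /=.
    by rewrite -big_distrr exchange_big.
  - rewrite disE big_distrr /=; apply: eq_bigr => a _.
    under eq_bigr => b _ do under eq_bigr => j _ do rewrite sum_nat_const card_ord.
    under eq_bigr => b _ do rewrite -big_distrr /=.
    by rewrite -big_distrr.
have [/existsP[a /existsP[b le_ab]]|] :=
    boolP [exists a, exists b, n * #|exceptions a b| <= 4 * #|disagreements|]%N.
  by exists a, b.
rewrite negb_exists => /forallP no; exfalso.
have: (\sum_(a < n) \sum_(b < n) (4 * #|disagreements|).+1 <=
    \sum_a \sum_b n * #|exceptions a b|)%N.
  apply: leq_sum => a _; apply: leq_sum => b _.
  by have := no a; rewrite negb_exists => /forallP/(_ b); rewrite -ltnNge.
rewrite !sum_nat_const !card_ord.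
under [X in (_ <= X)%N -> _]eq_bigr => a _ do rewrite -big_distrr /=.
rewrite -big_distrr /=; move: sum_ex; set s := (\sum_a _)%N; move: s #|disagreements| n_gt0.
by clear; nia.
Qed.

Lemma exceptionsP a b j k : (j, k) \notin exceptions a b ->
  (c j).1 = (c b).1 + e ((c a).2 b) + e ((c a).2 j) /\ (c j).2 k = (c a).2 k.
Proof.
rewrite !inE /= !negb_or !negbK.
move=> /and4P[/andP[_ /eqP->] /andP[/eqP D0 _] /andP[_ /eqP->] /andP[_ /eqP->]].
by split=> //; move: D0; rewrite /skew => D0; linear_F2 D0.
Qed.

End Agreement.

(** * Bad colourings *)

Local Notation coloring n := {ffun cube n -> bool}.

Definition compatible n (c : {ffun 'I_n -> frame n}) : {set coloring n} :=
  [set chi : coloring n | [forall p, chi (fpt c p) == chi (fpt c (swap p))]].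

Definition bad_families n s : {set coloring n} :=
  \bigcup_c if (2 * s <= #|fpt c @: conflicts c|)%N then compatible c else set0.

Lemma card_cube n : #|{: cube n}| = (2 ^ n)%N.
Proof. by rewrite card_ffun card_bool card_ord. Qed.

Lemma card_frame n : #|{: frame n}| = (2 ^ n * n ^ n)%N.
Proof. by rewrite card_prod !card_ffun card_bool !card_ord. Qed.

Lemma card_bad_families n s :
  (#|bad_families n s| * 2 ^ s <= (2 ^ n * n ^ n) ^ n * 2 ^ 2 ^ n)%N.
Proof.
have -> : ((2 ^ n * n ^ n) ^ n = #|{: {ffun 'I_n -> frame n}}|)%N.
  by rewrite card_ffun card_frame card_ord.
rewrite -(card_cube n).
apply: union_bound => c; case: ifP => [le_s|_]; last by rewrite cards0.
apply: (card_collapse _ le_s) => _ /imsetP[p + ->]; rewrite inE => /and4P[_ _ _ ne].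
exists (fpt c (swap p)); rewrite eq_sym; split=> // chi.
by rewrite inE => /forallP/(_ p)/eqP.
Qed.

(** * Comparison of two 2-balls up to shifts and few exceptions *)

Section SecondStep.
Variables n d : nat.
Local Notation pair := ('I_n * 'I_n)%type.
Local Notation config := (frame n * frame n * {ffun 'I_n -> option 'I_n} * d.-tuple pair)%type.

(* A configuration [(a, b, u, B)] compares the ball [a] with the ball [b] shifted by the vectors
   [opt_vec (u j)], except on the pairs in [B]. Listing at most [d] exceptions keeps the number of
   choices at [n ^ (2 * d)], whereas all sets of pairs would cost [2 ^ (n ^ 2)]. *)
Definition twin (g : config) (p : pair) : cube n :=
  pt g.1.1.2 p + opt_vec (g.1.2 p.1).

(** Good colourings are to satisfy [a.1 + b.1 = opt_vec (u j)] for some [j]; this is the situation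
    to be ruled out. *)
Definition twisted (g : config) : bool :=
  [&& injectiveb g.1.1.1.2, injectiveb g.1.1.2.2 &
      [forall j, g.1.1.1.1 + g.1.1.2.1 != opt_vec (g.1.2 j)]].

Definition matched (g : config) : {set coloring n} :=
  [set chi : coloring n |
    [forall p : pair, (p \notin g.2) ==> (chi (pt g.1.1.1 p) == chi (twin g p))]].

Definition bad_twins : {set coloring n} :=
  \bigcup_(g : config) if twisted g then matched g else set0.

(** A trivial equation writes [D + opt_vec (u j)] as a sum of four unit vectors. Then [D] has at
    most 5 support points and, by [supp_hit], the pair meets them under [a.2] or [b.2]: at most
    [10 * n] pairs for each. *)
Lemma card_trivial_pairs g : twisted g ->
  (#|[set p : pair | (p.1 != p.2) && (pt g.1.1.1 p == twin g p)]| <= 20 * n)%N.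
Proof.
case: g => [[[a b] u] beta]; rewrite /twisted /twin /=.
case/and3P=> /injectiveP a_inj /injectiveP b_inj /forallP D_u.
set Tr := [set p | _]; have [->|[p0 Trp0]] := set_0Vmem Tr; first by rewrite cards0.
pose D := a.1 + b.1; rewrite -/D in D_u.
have TrD p : p \in Tr ->
    e (a.2 p.1) + e (a.2 p.2) + (e (b.2 p.1) + e (b.2 p.2)) = D + opt_vec (u p.1).
  rewrite inE => /andP[_ /eqP]; rewrite /pt /D; move: (opt_vec _) => w H; linear_F2 H.
have le5 : (#|supp D| <= 5)%N.
  have := card_supp_sum (u p0.1) (a.2 p0.1) (a.2 p0.2) (b.2 p0.1) (b.2 p0.2).
  by rewrite TrD // add_selfK.
pose hit (f : {ffun 'I_n -> 'I_n}) := [set p | (f p.1 \in supp D) || (f p.2 \in supp D)].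
have leTr : (#|Tr| <= #|hit a.2| + #|hit b.2|)%N.
  apply: leq_trans (leq_card_setU _ _); rewrite subset_leq_card //.
  apply/subsetP=> p Trp; have := Trp; rewrite inE => /andP[p12 _].
  have := @supp_hit _ D (u p.1) (a.2 p.1) (a.2 p.2) (b.2 p.1) (b.2 p.2).
  rewrite (inj_eq a_inj) (inj_eq b_inj) => /(_ p12 p12 (D_u _) (TrD _ Trp)).
  by case/or4P=> h; apply/setUP; [left|left|right|right]; rewrite inE h ?orbT.
have := card_hit (supp D) a_inj; have := card_hit (supp D) b_inj.
rewrite -/(hit _) -/(hit _); move: leTr le5.
by move: #|Tr| #|hit _| #|hit _| #|supp D|; clear; nia.
Qed.

(** Dropping [n] diagonal, [d] listed and [20 * n] trivial pairs leaves at least [4 * s]. Two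
    orderings per point turn this into [2 * s] points for [card_collapse]. *)
Lemma card_matched g s : (4 * s + 21 * n + d <= n ^ 2)%N -> twisted g ->
  (#|matched g| * 2 ^ s <= 2 ^ #|{: cube n}|)%N.
Proof.
move=> le_s tw; pose S := [set p : pair | [&& p.1 != p.2, p \notin g.2 & pt g.1.1.1 p != twin g p]].
have leS : (#|S| <= 2 * #|pt g.1.1.1 @: S|)%N.
  apply: (@leq_card_fiber _ _ _ (pt g.1.1.1)) => [p|y _]; first exact: imset_f.
  case/and3P: tw => /injectiveP a_inj _ _.
  apply: leq_trans (card_pair_fiber g.1.1.1.1 y a_inj); rewrite subset_leq_card //.
  by apply/subsetP=> p; rewrite !inE => /andP[/and3P[-> _ _]].
have leT : (n ^ 2 <= #|S| + n + d + 20 * n)%N.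
  pose Dg := [set p : pair | p.1 == p.2].
  have leDg : (#|Dg| <= n)%N.
    rewrite -[leqRHS](card_ord n) -cardsT.
    apply: (@leq_card_injection _ _ _ _ (fun p => p.1)) => [[j k] [j' k']|//].
    by rewrite !inE /= => /eqP<- /eqP<- ->.
  have leB : (#|[set p in g.2]| <= d)%N.
    by rewrite cardsE (leq_trans (card_size _)) ?size_tuple.
  have := card_trivial_pairs tw; set Tr := [set p | _].
  have : [set: pair] \subset S :|: (Dg :|: ([set p in g.2] :|: Tr)).
    apply/subsetP=> p _; rewrite !inE; case: (p.1 == p.2) => //=.
    by case: (p \in g.2) => //=; rewrite orNb.
  move/subset_leq_card; rewrite cardsT card_prod card_ord -mulnn.
  have := leq_card_setU [set p in g.2] Tr; have := leq_card_setU Dg ([set p in g.2] :|: Tr).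
  have := leq_card_setU S (Dg :|: ([set p in g.2] :|: Tr)).
  have arith x y z t u v w : (y <= n -> z <= d -> u <= x + v -> v <= y + w -> w <= z + t ->
      n * n <= u -> t <= 20 * n -> n * n <= x + n + d + 20 * n)%N by clear; lia.
  exact: arith.
apply: (@card_collapse _ _ (pt g.1.1.1 @: S)); last first.
  have arith x y : (x <= 2 * y -> n ^ 2 <= x + n + d + 20 * n -> 2 * s <= y)%N by lia.
  exact: arith leS leT.
move=> _ /imsetP[p + ->]; rewrite inE => /and3P[_ pB ne].
exists (twin g p); rewrite eq_sym; split=> // chi.
by rewrite inE => /forallP/(_ p)/implyP/(_ pB)/eqP.
Qed.

Lemma card_bad_twins s : (4 * s + 21 * n + d <= n ^ 2)%N ->
  (#|bad_twins| * 2 ^ s <= (2 ^ n * n ^ n) ^ 2 * n.+1 ^ n * (n * n) ^ d * 2 ^ 2 ^ n)%N.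
Proof.
move=> le_s.
have -> : ((2 ^ n * n ^ n) ^ 2 * n.+1 ^ n * (n * n) ^ d = #|{: config}|)%N.
  by rewrite !card_prod card_tuple card_prod !card_ffun card_option card_bool !card_ord mulnn.
rewrite -(card_cube n); apply: union_bound => g.
by case: ifP => [|_]; [exact: card_matched | rewrite cards0].
Qed.

End SecondStep.

(** * Isomorphisms of 2-balls and rigidity *)

(** An injective map sending the finite edge set into itself sends it onto itself. *)
Lemma rel_homo_mono (T : finType) (r : rel T) (g : T -> T) : injective g ->
  (forall x y, r x y -> r (g x) (g y)) -> forall x y, r (g x) (g y) = r x y.
Proof.
move=> g_inj homo_g x y; apply/idP/idP=> [|/homo_g //].
pose S := [set p : T * T | r p.1 p.2]; pose G (p : T * T) := (g p.1, g p.2).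
have G_inj : injective G by move=> [? ?] [? ?] [/g_inj-> /g_inj->].
have eqS : G @: S = S.
  apply/eqP; rewrite eqEcard card_imset // leqnn andbT.
  by apply/subsetP=> _ /imsetP[p + ->]; rewrite !inE => /homo_g.
move=> rg; have : (g x, g y) \in G @: S by rewrite eqS inE.
by case/imsetP=> -[x' y']; rewrite inE /= => r' [/g_inj-> /g_inj->].
Qed.

Section Balls.
Variable n : nat.
Local Notation adj := (@cube_adj n).
Implicit Types (v w x y : cube n).

Lemma cube_adjP x y : reflect (exists i, y = x + e i) (adj x y).
Proof.
apply: (iffP cards1P) => -[i]; last first.
  move=> ->; exists i; apply/setP=> j; rewrite !inE !ffunE.
  by case: (x j); case: (j == i).
move=> /setP eq_i; exists i; apply/ffunP=> j; have := eq_i j; rewrite !inE !ffunE.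
by case: (x j); case: (y j); case: (j == i).
Qed.

Lemma adj_step x i : adj x (x + e i).
Proof. by apply/cube_adjP; exists i. Qed.

Lemma ball2P v w : reflect
  [\/ w = v, exists i, w = v + e i | exists i j, w = v + e i + e j]
  (w \in ball adj 2 v).
Proof.
rewrite inE; apply: (iffP existsP) => [[k /existsP[p /andP[+ /eqP <-]]]|].
  case: p => -[|x [|y [|? ?]]] /= sz; first by constructor.
  - by rewrite andbT => /cube_adjP[i ->]; constructor; exists i.
  - by rewrite andbT => /andP[/cube_adjP[i ->] /cube_adjP[j ->]]; constructor; exists i, j.
  - by have := ltn_ord k; rewrite -(eqP sz) !ltnS.
case=> [->|[i ->]|[i [j ->]]].
- by exists ord0; apply/existsP; exists [tuple]; rewrite /= eqxx.
- exists (@Ordinal 3 1 isT); apply/existsP; exists [tuple v + e i].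
  by rewrite /= adj_step eqxx.
- exists (@Ordinal 3 2 isT); apply/existsP; exists [tuple v + e i; v + e i + e j].
  by rewrite /= !adj_step eqxx.
Qed.

Lemma card_supp3 (i j k : 'I_n) : i != j -> i != k -> j != k ->
  (2 < #|supp (e i + e j + e k)%R|)%N.
Proof.
move=> ij ik jk; apply: (@leq_trans #|i |: [set j; k]|).
  by rewrite cardsU1 cards2 !inE negb_or ij ik jk.
apply/subset_leq_card/subsetP=> z; rewrite !inE !ffunE.
by case/or3P=> /eqP->; rewrite eqxx ?(negPf ij) ?(negPf ik) ?(negPf jk) //
  1?eq_sym ?(negPf ij) ?(negPf ik) ?(negPf jk) // 1?(eq_sym k j) ?(negPf jk) //.
Qed.

Lemma exists_third (i j : 'I_n) : (2 < n)%N -> exists k, k != i /\ k != j.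
Proof.
move=> n3; have : (0 < #|~: [set i; j]|)%N.
  by rewrite cardsCs setCK card_ord cards2 subn_gt0 (leq_ltn_trans _ n3) //; case: (_ != _).
by case/card_gt0P=> k; rewrite !inE negb_or => /andP[]; exists k.
Qed.

Lemma ball2_center v c : (2 < n)%N -> c \in ball adj 2 v ->
  {subset ball adj 2 v <= ball adj 2 c} -> c = v.
Proof.
move=> n3 /ball2P c_v v_c.
have no3 y i j k : y \in ball adj 2 v -> y + c = e i + e j + e k ->
    i != j -> i != k -> j != k -> False.
  move=> /v_c/ball2P y_c eq_yc ij ik jk; have := card_supp3 ij ik jk; rewrite -eq_yc.
  suff: (#|supp (y + c)%R| <= 2)%N by case: ltngtP.
  case: y_c => [->|[a ->]|[a [b ->]]].
  - by rewrite add_self (_ : supp _ = set0) ?cards0 //; apply/setP=> z; rewrite !inE ffunE.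
  - by rewrite addrAC add_self add0r card_supp_unit.
  - have -> : c + e a + e b + c = e a + e b by ident_F2.
    by rewrite (leq_trans (card_suppD _ _)) // !card_supp_unit.
case: c_v => [//|[i c_i]|[i [j c_ij]]].
  have [j [ji _]] := exists_third i i n3; have [k [ki kj]] := exists_third i j n3.
  case: (no3 (v + e j + e k) i j k); rewrite 1?eq_sym //.
    by apply/ball2P; constructor; exists j, k.
  by rewrite c_i; ident_F2.
have [ij|ij] := eqVneq i j; first by rewrite c_ij ij -addrA add_self addr0.
have [k [ki kj]] := exists_third i j n3.
case: (no3 (v + e k) i j k); rewrite // 1?eq_sym //.
  by apply/ball2P; constructor; exists k.
by rewrite c_ij; ident_F2.
Qed.
End Balls.

(** Trades an isomorphism of subtypes for a map on the whole vertex set, going backwards from [B] to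
    [A], so that cube arithmetic applies to it. *)
Lemma col_equiv_inverse (C : Type) (T : finType) (r : rel T) (A B : {set T}) (chi lam : T -> C) :
  col_equiv (@induced T r A) (@induced T r B)
    (fun x : {x | x \in A} => chi (val x)) (fun x : {x | x \in B} => lam (val x)) ->
  exists q : T -> T,
    [/\ forall x, x \in B -> q x \in A,
        {in B &, injective q},
        {in B &, forall x y, r x y -> r (q x) (q y)},
        {in B, forall x, lam x = chi (q x)} &
        forall y, y \in A -> exists2 x, x \in B & y = q x].
Proof.
move=> [phi [[psi phiK psiK] phi_r] phi_col].
pose q x := oapp (fun s => val (psi s)) x (insub x : option {x | x \in B}).
have qE x (xB : x \in B) : q x = val (psi (exist _ x xB)) by rewrite /q insubT.
exists q; split.
- by move=> x xB; rewrite (qE _ xB); exact: valP.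
- by move=> x y xB yB; rewrite (qE _ xB) (qE _ yB) => /val_inj/(can_inj psiK)[].
- move=> x y xB yB; rewrite (qE _ xB) (qE _ yB).
  by have := phi_r (psi (exist _ x xB)) (psi (exist _ y yB)); rewrite !psiK /induced => ->.
- by move=> x xB; rewrite (qE _ xB) phi_col /= psiK.
- move=> y yA; exists (val (phi (exist _ y yA))); first exact: valP.
  by rewrite /q valK /= phiK.
Qed.

Section BallFrames.
Variable n : nat.
Local Notation adj := (@cube_adj n).

(** Neighbours of the centre define [tau]. For distinct [i] and [j], the vertex w + e_i + e_j goes
    to a common neighbour of the images of w + e_i and w + e_j other than [v], and there is only
    one. *)
Lemma ball_frame (chi lam : cube n -> bool) v w : (2 < n)%N ->
  col_equiv (@induced _ adj (ball adj 2 v)) (@induced _ adj (ball adj 2 w))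
    (@col_ball _ _ adj 2 chi v) (@col_ball _ _ adj 2 lam w) ->
  exists tau : {ffun 'I_n -> 'I_n}, [/\ injective tau,
    forall i, lam (w + e i) = chi (v + e (tau i)) &
    forall i j, lam (w + e i + e j) = chi (v + e (tau i) + e (tau j))].
Proof.
move=> n3 /col_equiv_inverse[q [q_ball q_inj q_adj q_col q_onto]].
have w0 : w \in ball adj 2 w by apply/ball2P; constructor.
have w1 i : w + e i \in ball adj 2 w by apply/ball2P; constructor; exists i.
have w2 i j : w + e i + e j \in ball adj 2 w by apply/ball2P; constructor; exists i, j.
have qw : q w = v.
  apply: (ball2_center n3) => [|y /q_onto[x xw ->]]; first exact: q_ball.
  apply/ball2P; move/ball2P: (xw) => [->|[i ->]|[i [j ->]]]; first by constructor.
    by have /cube_adjP[a ->] := q_adj _ _ w0 (w1 i) (adj_step _ _); constructor; exists a.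
  have /cube_adjP[b ->] := q_adj _ _ (w1 i) (w2 i j) (adj_step _ _).
  by have /cube_adjP[a ->] := q_adj _ _ w0 (w1 i) (adj_step _ _); constructor; exists a, b.
have q1 i : exists a, q (w + e i) == v + e a.
  by have /cube_adjP[a ->] := q_adj _ _ w0 (w1 i) (adj_step _ _); exists a; rewrite qw.
pose tau := [ffun i => xchoose (q1 i)].
have tauP i : q (w + e i) = v + e (tau i) by rewrite ffunE; apply/eqP/(xchooseP (q1 i)).
have tau_inj : injective tau.
  move=> i j ij; apply/unit_vec_inj/(addrI w)/q_inj => //.
  by rewrite !tauP ij.
exists tau; split=> // [i|i j]; first by rewrite q_col // tauP.
rewrite q_col //; congr (chi _).
have [<-|ij] := eqVneq i j; first by rewrite !add_selfK qw.
have /cube_adjP[a qa] := q_adj _ _ (w1 i) (w2 i j) (adj_step _ _).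
have /cube_adjP[b qb] : adj (q (w + e j)) (q (w + e i + e j)).
  by apply: q_adj => //; rewrite addrAC adj_step.
have eq_ab : e a + e (tau i) = e b + e (tau j).
  by move: qa; rewrite qb !tauP => H; linear_F2 H.
(* With [a = tau i] the vertex at distance 2 would be sent to [v], which is already the image of
   [w]. *)
have ne_a : a != tau i.
  apply: contra_neq ij => ea; apply/unit_vec_inj/(addrI w).
  have := q_inj _ _ (w2 i j) w0; rewrite qa tauP ea add_selfK qw => /(_ erefl).
  by move/add_eq_swap.
have [[_ /tau_inj ij']|[ea _]] := add_unit_eq ne_a eq_ab; last by rewrite qa tauP ea.
by rewrite ij' eqxx in ij.
Qed.

End BallFrames.

Section Rigidity.
Variables (n t s d : nat).
Hypotheses (n3 : (2 < n)%N) (t_gt0 : (0 < t)%N) (le_s : (t ^ 2 * s <= n ^ 3)%N)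
  (le_d : (88 * n ^ 2 + 16 * t * n <= t * d)%N).
Local Notation adj := (@cube_adj n).

(** [card_conflicts] gives at most [22 * n ^ 3 / t] conflicts. Adding [4 * n ^ 2] and multiplying by
    [4 / n] yields [88 * n ^ 2 / t + 16 * n], the bound built into [le_d]. *)
Lemma few_exceptions (c : {ffun 'I_n -> frame n}) :
  injective (fun i => (c i).1) -> (forall i, injective (c i).2) ->
  (#|fpt c @: conflicts c| < 2 * s)%N -> exists a b, (#|exceptions c a b| <= d)%N.
Proof.
move=> c_inj pi_inj lt_s.
have [a [b le_ex]] := exists_few_exceptions c (ltn_trans (isT : 0 < 2)%N n3).
exists a, b; have le1 := card_conflicts c_inj pi_inj t; have le2 := card_disagreements pi_inj.
have arith x y z u : (y < 2 * s -> 2 * t * x <= t ^ 2 * y + 42 * n ^ 3 ->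
    z <= x + 4 * n ^ 2 -> n * u <= 4 * z -> u <= d)%N.
  move=> lt_y le_x le_z le_u.
  have le_tx : (t * x <= 22 * n ^ 3)%N.
    have : (t ^ 2 * y <= t ^ 2 * (2 * s))%N by rewrite leq_mul2l (ltnW lt_y) orbT.
    by move: le_x le_s; rewrite mulnCA; lia.
  have n_gt0 : (0 < t * n)%N by rewrite muln_gt0 t_gt0 (ltn_trans _ n3).
  rewrite -(leq_pmul2l n_gt0).
  have : (t * (n * u) <= t * (4 * (x + 4 * n ^ 2)))%N.
    by rewrite leq_mul2l (leq_trans le_u) ?orbT // leq_mul2l le_z orbT.
  have : (n * (88 * n ^ 2 + 16 * t * n) <= n * (t * d))%N by rewrite leq_mul2l le_d orbT.
  by move: le_tx; rewrite !expnS !expn0; clear; nia.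
exact: (arith _ _ _ _ lt_s le1 le2 le_ex).
Qed.

Lemma local_equiv_rigid (chi : coloring n) (lam : cube n -> bool) :
  chi \notin bad_families n s -> chi \notin bad_twins n d ->
  local_equiv adj 2 chi lam -> col_equiv adj adj chi lam.
Proof.
move=> good1 good2 [f [g fK gK] f_ball].
have frameP w : exists tau : {ffun 'I_n -> 'I_n}, [&& injectiveb tau,
    [forall i, lam (w + e i) == chi (g w + e (tau i))] &
    [forall i, forall j, lam (w + e i + e j) == chi (g w + e (tau i) + e (tau j))]].
  have := f_ball (g w); rewrite gK => /(ball_frame n3)[tau [tau_inj tau1 tau2]].
  exists tau; apply/and3P; split; first exact/injectiveP.
    by apply/forallP=> i; rewrite tau1.
  by apply/forallP=> i; apply/forallP=> j; rewrite tau2.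
have [fr [frg fr_inj fr1 fr2]] : exists fr : cube n -> frame n,
    [/\ forall w, (fr w).1 = g w, forall w, injective (fr w).2,
        forall w i, lam (w + e i) = chi ((fr w).1 + e ((fr w).2 i)) &
        forall w i j, lam (w + e i + e j) = chi (pt (fr w) (i, j))].
  exists (fun w => (g w, xchoose (frameP w))); split=> // w.
  - by have /and3P[/injectiveP] := xchooseP (frameP w).
  - by move=> i; have /and3P[_ /forallP/(_ i)/eqP] := xchooseP (frameP w).
  - by move=> i j; have /and3P[_ _ /forallP/(_ i)/forallP/(_ j)/eqP] := xchooseP (frameP w).
have g_inj : injective g := can_inj gK.
have frames_around w : exists v (sigma : {ffun 'I_n -> 'I_n}) (B : d.-tuple ('I_n * 'I_n)),
    injective sigma /\ forall j k, (j, k) \notin B ->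
      (fr (w + e j)).1 = v + e (sigma j) /\ (fr (w + e j)).2 k = sigma k.
  pose c := [ffun i => fr (w + e i)].
  have cE i : c i = fr (w + e i) by rewrite ffunE.
  have c_inj : injective (fun i => (c i).1).
    by move=> i j; rewrite !cE !frg => /g_inj/addrI/unit_vec_inj.
  have pi_inj i : injective (c i).2 by rewrite cE; exact: fr_inj.
  have compat : chi \in compatible c.
    rewrite inE; apply/forallP=> -[i [j k]].
    by rewrite /fpt /swap !cE -!fr2 [w + e j + _]addrAC.
  have lt_s : (#|fpt c @: conflicts c| < 2 * s)%N.
    rewrite ltnNge; apply: contraNN good1 => le_c; apply/bigcupP; exists c => //.
    by rewrite le_c.
  have [a [b le_ex]] := few_exceptions c_inj pi_inj lt_s.
  have [B subB] := subset_tuple (a, b) le_ex.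
  exists ((c b).1 + e ((c a).2 b)), (c a).2, B; split=> // j k jkB.
  have: (j, k) \notin exceptions c a b by apply: contraNN jkB; exact: subB.
  by move=> /exceptionsP; rewrite (cE j).
have twinP (a b : frame n) (u : {ffun 'I_n -> option 'I_n}) (B : d.-tuple ('I_n * 'I_n)) :
    injective a.2 -> injective b.2 ->
    (forall j k, (j, k) \notin B -> chi (pt a (j, k)) = chi (pt b (j, k) + opt_vec (u j))) ->
    exists j, a.1 + b.1 = opt_vec (u j).
  move=> a_inj b_inj eq_chi.
  have [/existsP[j /eqP]|no_j] := boolP [exists j, a.1 + b.1 == opt_vec (u j)]; first by exists j.
  case/negP: good2; apply/bigcupP; exists (a, b, u, B) => //.
  rewrite ifT; last first.
    apply/and3P; split; [exact/injectiveP | exact/injectiveP |].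
    by rewrite -negb_exists.
  rewrite inE; apply/forallP=> -[j k]; apply/implyP=> jkB.
  by rewrite /twin /= eq_chi.
have g_adj w l : adj (g w) (g (w + e l)).
  have [v [sigma [B [sigma_inj BP]]]] := frames_around w.
  have gw : g w = v.
    have [|//|j k jkB|j] := twinP (fr w) (v, sigma) [ffun=> None] B; first exact: fr_inj.
      have [e1 e2] := BP _ _ jkB.
      by rewrite -fr2 fr1 e1 e2 ffunE /= addr0.
    by rewrite ffunE frg => /add_eq0_eq.
  (* The vertex w + e_l + e_j + e_k is read from the ball around w + e_j, whose centre and image of
     [k] are known. The image of [l] there may be exceptional, so it enters as the free shift
     [u j]. *)
  have [||j k jkB|j] := twinP (fr (w + e l)) (v, sigma)
      [ffun j => Some ((fr (w + e j)).2 l)] B; [exact: fr_inj | by [] | |].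
    have [e1 e2] := BP _ _ jkB.
    have -> : chi (pt (fr (w + e l)) (j, k)) = chi (pt (fr (w + e j)) (k, l)).
      by rewrite -!fr2; congr (lam _); ident_F2.
    by rewrite ffunE /pt /= e1 e2.
  rewrite ffunE /= frg => eq_l; apply/cube_adjP; exists ((fr (w + e j)).2 l).
  by rewrite gw -eq_l; ident_F2.
have g_homo x y : adj x y -> adj (g x) (g y) by case/cube_adjP=> l ->.
exists f; last first.
  (* Using direction [i] twice returns to the centre, so the frame at [f x] compares [lam (f x)]
     with [chi x]. *)
  move=> x /=; have i : 'I_n := Ordinal (ltn_trans (isT : 0 < 2)%N n3).
  by have := fr2 (f x) i i; rewrite /pt /= !add_selfK frg fK.
split; first by exists g.
by move=> x y; have := rel_homo_mono g_inj g_homo (f x) (f y); rewrite !fK.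
Qed.

End Rigidity.

(** * Proportions *)

From mathcomp Require Import classical_sets boolp reals topology normedtype sequences.

Import Num.Theory Order.TTheory numFieldNormedType.Exports.

Local Open Scope nat_scope.

(** Since [2 ^ L.-1 < n], powers of 2 suffice. With [q = L.+2 %/ 8], [L.+2] is at most [2 ^ (3 + q)]
    and 1408 at most [2 ^ 11], so the left side is at most [2 ^ (31 + 3 * q)]. This fits once [q] is
    at least 7, which is what 54 ensures. *)
Lemma cube_log_bound m n : 54 <= m -> 2 ^ m <= n ->
  (1408 * (up_log 2 n).+1) ^ 2 * (up_log 2 n).+2 <= n.
Proof.
move=> m54 le_n; set L := up_log 2 n.
have n_gt1 : 1 < n by apply: leq_trans le_n; rewrite -[1]/(2 ^ 0) ltn_exp2l //; lia.
have mL : m <= L by rewrite -(@leq_exp2l 2) // (leq_trans le_n) // up_logP.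
have lt_n : 2 ^ L.-1 < n := up_log_gtn (isT : 1 < 2) n_gt1.
apply: leq_trans (ltnW lt_n); pose q := L.+2 %/ 8.
have le_L : L.+2 <= 2 ^ (3 + q).
  have := ltn_expl q (isT : 1 < 2); rewrite expnD.
  by have := ltn_ceil L.+2 (isT : 0 < 8); rewrite -/q; move: (2 ^ q); lia.
have le_k : 1408 * L.+1 <= 2 ^ 11 * 2 ^ (3 + q) by apply: leq_mul; [lia | exact: ltnW].
apply: (@leq_trans ((2 ^ 11 * 2 ^ (3 + q)) ^ 2 * 2 ^ (3 + q))).
  by rewrite leq_mul // leq_exp2r.
rewrite -!expnD -expnM -expnD leq_exp2l //.
have q7 : 7 <= q by rewrite /q leq_divRL //; move: (leq_trans m54 mL); clear; lia.
by have := leq_divM L.+2 8; rewrite -/q; move: q7; clear; lia.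
Qed.

(* [t] is the Cauchy-Schwarz parameter: a large multiple of [log n], so that [d] exceptions cost
   [d * log n << n ^ 2] bits, but with [t ^ 2 * log n <= n]. *)
Lemma card_bad_colorings n (L := up_log 2 n) (t := 1408 * L.+1)
    (d := (88 * n ^ 2) %/ t + 16 * n + 1) (s := n * (n + n * L) + n) :
  2 < n -> t ^ 2 * L.+2 <= n ->
  [/\ #|bad_families n s| * 2 ^ n <= 2 ^ 2 ^ n,
      #|bad_twins n d| * 2 ^ n <= 2 ^ 2 ^ n,
      t ^ 2 * s <= n ^ 3 & 88 * n ^ 2 + 16 * t * n <= t * d].
Proof.
move=> n3 le_t; have n_le : n <= 2 ^ L by exact: up_logP.
have t_gt0 : 0 < t by [].
have le_nn : n ^ n <= 2 ^ (n * L) by rewrite mulnC expnM leq_exp2r //; lia.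
have le_frame : 2 ^ n * n ^ n <= 2 ^ (n + n * L) by rewrite expnD leq_mul2l le_nn orbT.
have le_d : 88 * n ^ 2 + 16 * t * n <= t * d.
  rewrite /d; have := ltn_ceil (88 * n ^ 2) t_gt0; move: (_ %/ _) => q; clear; nia.
split=> //.
(* In [s], the product bounds the bits needed to choose a family; the last [n] yields the factor
   [2 ^ n]. *)
- rewrite -(@leq_pmul2r (2 ^ (n * (n + n * L)))) ?expn_gt0 // -mulnA -expnD [n + _]addnC -/s.
  apply: leq_trans (card_bad_families n s) _; rewrite mulnC.
  by apply: leq_mul => //; rewrite [n * (n + _)]mulnC expnM leq_exp2r //; lia.
(* [u] bounds the bits of a configuration: two frames, [n] optional directions and [d] pairs. *)
- pose u := (n + n * L) * 2 + L.+1 * n + (L * 2) * d.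
  have le_u : (2 ^ n * n ^ n) ^ 2 * n.+1 ^ n * (n * n) ^ d <= 2 ^ u.
    rewrite /u 2!expnD; apply: leq_mul; first apply: leq_mul.
    + by rewrite expnM leq_exp2r.
    + rewrite expnM leq_exp2r; last by lia.
      by rewrite expnS; move: n_le; lia.
    + by rewrite expnM leq_exp2r ?expnM -?mulnn ?leq_mul // /d addn1.
  rewrite -(@leq_pmul2r (2 ^ u)) ?expn_gt0 // -mulnA -expnD [n + _]addnC.
  apply: leq_trans (card_bad_twins _) _; last by rewrite mulnC leq_mul2l le_u orbT.
  have le_d' : t * d <= 88 * n ^ 2 + 16 * t * n + t.
    by rewrite /d; have := leq_divM (88 * n ^ 2) t; move: (_ %/ _) => q; clear; nia.
  have le_n : 370 * L.+1 <= n.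
    apply: leq_trans le_t; rewrite /t; clear; nia.
  (* Exceptions cost [(8 * L + 1) * d], with main term at most [n ^ 2 / 2] because 1408 = 16 * 88.
     The remaining terms have order [n * L.+1] and are absorbed by [le_n]. *)
  move: le_d' le_n; rewrite /u /t; clear; nia.
- apply: leq_trans (_ : t ^ 2 * (L.+2 * n ^ 2) <= _).
    by rewrite leq_mul2l /s; apply/orP; right; clear; nia.
  by rewrite mulnA expnS leq_mul2r le_t orbT.
Qed.

Lemma card_indistinguishable m n : 54 <= m -> 2 ^ m <= n ->
  #|[pred chi : coloring n | ~~ `[< distinguishable (@cube_adj n) 2 chi >]]| * 2 ^ n
    <= 2 * 2 ^ 2 ^ n.
Proof.
move=> m54 le_n; have le_t := cube_log_bound m54 le_n.
have n3 : 2 < n by rewrite (leq_trans _ le_n) // (leq_trans _ (ltnW (ltn_expl m _))) //; lia.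
have [le1 le2 le_s le_d] := card_bad_colorings n3 le_t.
rewrite mul2n -addnn; apply: leq_trans (leq_add le1 le2); rewrite -mulnDl leq_mul2r.
apply/orP; right; apply: leq_trans (leq_card_setU _ _); apply: subset_leq_card.
apply/fintype.subsetP=> chi; rewrite inE; apply: contraR.
rewrite finset.in_setU negb_or => /andP[good1 good2].
apply/asboolP=> -[lam [loc]]; apply.
exact: (local_equiv_rigid n3 _ le_s le_d good1 good2 loc).
Qed.

Local Open Scope classical_set_scope.
Local Open Scope ring_scope.

Theorem theorem1p1 (R : realType) :
  proportion R
    (fun chi : {ffun cube n -> bool} => distinguishable (@cube_adj n) 2 chi)
      @[n --> \oo] --> (1 : R).
Proof.
(* The failing proportion is at most [2 / 2 ^ n]; weakening [2 ^ n] to [n + 1] gives a bound by the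
   harmonic sequence. *)
apply: (@squeeze_cvgr _ _ _ _ (fun n => 1 - 2 * harmonic n) (fun=> 1)); last 1 first.
- exact: cvg_cst.
- have [m m54] : exists m, (54 <= m)%N by exists 54%N.
  exists (2 ^ m)%N => // n /= le_n.
  have := card_indistinguishable m54 le_n; set D := [pred chi | ~~ _].
  rewrite /proportion; set G := [pred chi | `[< _ >]]; set M := #|{: coloring n}|.
  have M_gt0 : (0 < M)%N by rewrite /M card_ffun card_bool expn_gt0.
  have MG : (#|G| + #|D| = M)%N by rewrite /M -(cardC G); congr addn; exact: eq_card.
  have -> : (2 ^ 2 ^ n = M)%N by rewrite /M card_ffun card_bool card_cube.
  move=> le_D; apply/andP; split; last first.
    by rewrite ler_pdivrMr ?ltr0n // mul1r ler_nat -MG leq_addr.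
  rewrite ler_pdivlMr ?ltr0n // mulrBl mul1r lerBlDr -{1}MG natrD lerD2l.
  rewrite /harmonic mulrAC ler_pdivlMr ?ltr0n // -!natrM ler_nat.
  by apply: leq_trans le_D; rewrite leq_mul2l ltn_expl ?orbT.
- rewrite -[X in _ --> X](subr0 (1 : R)) -(mulr0 (2 : R)).
  by apply: cvgB; [exact: cvg_cst | apply: cvgM; [exact: cvg_cst | exact: cvg_harmonic]].
Qed.
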